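(* Let $G\subset\mathbb{R}^n$ be a fixed open set (or all of $\mathbb{R}^n$), and consider the space of Borel probability measures supported on $G$, with the weak topology. If $\mu$ is a strictly negatively associated probability measure on $G$, then every weak neighborhood of $\mu$ contains a probability measure $\nu$ that is not negatively associated.
   Context: A function $f:\mathbb{R}^m\to\mathbb{R}$ is non-decreasing if $f(x)\ge f(y)$ whenever $x\ge y$ coordinatewise. For $I\subset\{1,\dots,n\}$, $x_I\in\mathbb{R}^{|I|}$ is the restriction of $x\in\mathbb{R}^n$ to the coordinates in $I$. A Borel probability measure $\mu$ on $\mathbb{R}^n$ is negatively associated (NA) if for all disjoint $I,J\subset\{1,\dots,n\}$ and all non-decreasing integrable $f:\mathbb{R}^{|I|}\to\mathbb{R}$, $g:\mathbb{R}^{|J|}\to\mathbb{R}$, $$\int f(x_I)g(x_J)\,d\mu(x)\le\int f(x_I)\,d\mu(x)\int g(x_J)\,d\mu(x).$$ It is strictly NA if strict inequality holds for all such $f(x_I),g(x_J)$ that are not $\mu$-almost surely constant, and all disjoint $I,J$. The weak topology is the topology of convergence in distribution on probability measures: basic neighborhoods of $\mu$ are the sets $\{\nu: |\int f_i\,d\nu-\int f_i\,d\mu|<\epsilon_i,\ i=1,\dots,k\}$ with $f_1,\dots,f_k$ bounded continuous and $\epsilon_i>0$.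
   Formalization: The dimension n is assumed to be at least 2; for n at most 1 one of two disjoint index sets is empty, so every probability measure is negatively associated (and vacuously strictly so), and the claim fails. *)

(* Defs.v *)
From HB Require Import structures.
From mathcomp Require Import all_boot all_order all_algebra.
From mathcomp Require Import all_classical all_reals all_analysis.
Import Order.TTheory GRing.Theory Num.Theory.
Import numFieldNormedType.Exports.

Set Implicit Arguments.
Unset Strict Implicit.
Unset Printing Implicit Defensive.

Local Open Scope classical_set_scope.
Local Open Scope ring_scope.

Section defs.
Context {R : realType}.

(* 'rV[R]_n carries the product (i.e. Euclidean) topology but no measurable
   structure in the library, hence this alias with its Borel sigma-algebra. *)
Definition borel_rV (n : nat) := g_sigma_algebraType (@open 'rV[R]_n).

Definition nondecreasing_coord (m : nat) (f : 'rV[R]_m -> R) : Prop :=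
  forall x y : 'rV[R]_m, (forall i, y 0 i <= x 0 i) -> f y <= f x.

Definition restrict_coord (n : nat) (I : {set 'I_n}) (x : 'rV[R]_n) :
    'rV[R]_#|I| :=
  \row_(k < #|I|) x 0 (enum_val k).

Section association.
Context (n : nat) (mu : probability (borel_rV n) R).

(* The function x |-> f(x_I), on the measurable space carrying mu. *)
Definition on_coord (I : {set 'I_n}) (f : 'rV[R]_#|I| -> R) :
    borel_rV n -> R :=
  fun x => f (restrict_coord I x).

Definition test_function (I : {set 'I_n}) (f : 'rV[R]_#|I| -> R) : Prop :=
  nondecreasing_coord f /\ mu.-integrable setT (EFin \o on_coord f).

Definition ae_constant (h : borel_rV n -> R) : Prop :=
  exists c : R, {ae mu, forall x, h x = c}.

(* Only the two factors are assumed integrable; the integral of the product is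
   taken in \bar R, where oo - oo evaluates to -oo.  This convention is harmless:
   the inequality for the bounded truncations of f^+, g^+ and of -f^-, -g^-
   already makes the positive part of the product integrable. *)
Definition negatively_associated : Prop :=
  forall I J : {set 'I_n}, [disjoint I & J]%B ->
  forall (f : 'rV[R]_#|I| -> R) (g : 'rV[R]_#|J| -> R),
    test_function f -> test_function g ->
    (\int[mu]_x (on_coord f x * on_coord g x)%:E <=
     \int[mu]_x (on_coord f x)%:E * \int[mu]_x (on_coord g x)%:E)%E.

Definition strictly_negatively_associated : Prop :=
  forall I J : {set 'I_n}, [disjoint I & J]%B ->
  forall (f : 'rV[R]_#|I| -> R) (g : 'rV[R]_#|J| -> R),
    test_function f -> test_function g ->
    ~ ae_constant (on_coord f) -> ~ ae_constant (on_coord g) ->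
    (\int[mu]_x (on_coord f x * on_coord g x)%:E <
     \int[mu]_x (on_coord f x)%:E * \int[mu]_x (on_coord g x)%:E)%E.

End association.

Section weak_topology.
Context (n : nat) (G : set 'rV[R]_n).

Definition prob_on : set (probability (borel_rV n) R) :=
  [set mu : probability (borel_rV n) R | mu (G : set (borel_rV n)) = 1%E].

Definition bounded_continuous_on (f : 'rV[R]_n -> R) : Prop :=
  {within G, continuous f} /\ exists M : R, forall x, G x -> `|f x| <= M.

Definition weak_basic_nbhs (mu : probability (borel_rV n) R) (k : nat)
    (f : 'I_k -> 'rV[R]_n -> R) (eps : 'I_k -> R) :
    set (probability (borel_rV n) R) :=
  [set nu | prob_on nu /\
    forall i, `|Rintegral nu (G : set (borel_rV n)) (f i) -
                Rintegral mu (G : set (borel_rV n)) (f i)| < eps i].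

(* U is a neighborhood of mu in the space of probability measures on G.  The
   test functions are only required to be continuous on G, not on all of R^n,
   as for the weak topology of the topological space G. *)
Definition weak_nbhs (mu : probability (borel_rV n) R)
    (U : set (probability (borel_rV n) R)) : Prop :=
  exists (k : nat) (f : 'I_k -> 'rV[R]_n -> R) (eps : 'I_k -> R),
    [/\ forall i, bounded_continuous_on (f i),
        forall i, 0 < eps i
      & weak_basic_nbhs mu f eps `<=` U].

End weak_topology.

End defs.
Arguments borel_rV : clear implicits.

(* Main.v *)
Require Import Defs.
From HB Require Import structures.
From mathcomp Require Import all_boot all_order all_algebra.
From mathcomp Require Import all_classical all_reals all_analysis.
From mathcomp Require Import lra.
Import Order.TTheory GRing.Theory Num.Theory.
Import numFieldNormedType.Exports.

Set Implicit Arguments.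
Unset Strict Implicit.
Unset Printing Implicit Defensive.

Local Open Scope classical_set_scope.
Local Open Scope ring_scope.

(** Every probability measure [mu] on a nonempty open set [G] of dimension at
    least two is a weak limit of measures on [G] violating negative association,
    because negative association already fails on a pair of rare events.

    Fix two coordinates [i != j].  Since [G] is open, the first of them has no
    largest value on [G], so there are points [x] of [G] beyond which almost no
    mass of [mu] remains: [mu (X_i > x_i) <= t^2/4] ([small_upper_tail]).  As
    [G] is open, it also contains [z = x + (h, ..., h)] for some [h > 0].  Let
    [nu = (1 - t) mu + (t/2) (delta_x + delta_z)].

    Consider the events [X_i > x_i] and [X_j > x_j].  The point [z] lies in
    both, so their intersection has [nu]-measure at least [t/2].  The first one
    is charged by little else than [z], so its measure is at most
    [t/2 + t^2/4]; the second one misses [x], so its measure is at most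
    [1 - t/2].  The product of these two bounds is [t/2 - t^3/8 < t/2], hence
    the events are positively correlated under [nu]
    ([not_NA_two_point_mixture]), although negative association forbids this
    for upper tails of distinct coordinates ([upper_tails_NA]).

    Finally, moving mass [t] changes the integral of a function bounded by [M]
    by at most [2 t M] ([Rintegral_mixture_dist]), so for small [t] the measure
    [nu] lies in any prescribed weak neighborhood of [mu]. *)

(** * Mixtures of two probability measures *)

Section mixture.
Context d (T : measurableType d) (R : realType).
Variables (t : {i01 R}) (p q : probability T R).

Definition mixture : set T -> \bar R :=
  measure_add (mscale (1 - t%:num)%:nng p) (mscale (t%:num)%:nng q).

HB.instance Definition _ := Measure.on mixture.

Lemma mixtureE (A : set T) :
  mixture A = ((1 - t%:num)%:E * p A + t%:num%:E * q A)%E.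
Proof. by rewrite /mixture measure_addE. Qed.

Let mixture_setT : mixture setT = 1%E.
Proof.
by rewrite mixtureE !probability_setT !mule1 -EFinD subrK.
Qed.

HB.instance Definition _ :=
  Measure_isProbability.Build _ _ _ mixture mixture_setT.

End mixture.

(** The positive and negative parts are scaled separately; integrability makes
    their difference distribute over the product in the extended reals. *)
Lemma integral_mscale d (T : measurableType d) (R : realType)
    (m : {measure set T -> \bar R}) (D : set T) (k : {nonneg R})
    (f : T -> \bar R) :
  measurable D -> m.-integrable D f ->
  (\int[mscale k m]_(x in D) f x = k%:num%:E * \int[m]_(x in D) f x)%E.
Proof.
move=> mD fi; have mf := measurable_int _ fi.
rewrite (integralE (mscale k m)) (integralE m) muleBr//; last first.
  by rewrite fin_num_adde_defl// fin_numN; apply: integrable_neg_fin_num.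
rewrite !ge0_integral_mscale//.
  exact: measurable_realfun.measurable_funeneg.
exact: measurable_realfun.measurable_funepos.
Qed.

(** * Integrals of bounded functions against mixtures *)

Section bounded.
Context d (T : measurableType d) (R : realType).
Implicit Types (p q : probability T R) (D : set T) (f : T -> R) (M : R).

Lemma bounded_integrable (m : {finite_measure set T -> \bar R}) D f M :
  measurable D -> measurable_fun D f -> (forall x, D x -> `|f x| <= M) ->
  m.-integrable D (EFin \o f).
Proof.
move=> mD mf fM; apply: measurable_bounded_integrable => //.
  by rewrite ltey_eq fin_num_measure.
by exists M; split => [|r Mr x Dx]; [exact: num_real|
  exact: le_trans (fM x Dx) (ltW Mr)].
Qed.

Lemma normr_Rintegral_le p D f M : 0 <= M ->
  measurable D -> measurable_fun D f -> (forall x, D x -> `|f x| <= M) ->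
  `|Rintegral p D f| <= M.
Proof.
move=> M0 mD mf fM.
have fi := bounded_integrable p mD mf fM.
apply: (le_trans (le_normr_Rintegral mD fi)).
have Mi : p.-integrable D (EFin \o cst M).
  apply: (@bounded_integrable _ _ _ M) => // x _.
  by rewrite ger0_norm.
apply: (le_trans (le_Rintegral mD _ Mi fM)).
  exact: (integrable_norm fi).
rewrite Rintegral_cst// ler_piMr// -lee_fin fineK ?fin_num_measure//.
exact: probability_le1.
Qed.

(** The two integrals differ by [t] times the difference of the integrals
    against [q] and [p], each of which is at most [M] in absolute value. *)
Lemma Rintegral_mixture_dist t p q D f M : 0 <= M ->
  measurable D -> measurable_fun D f -> (forall x, D x -> `|f x| <= M) ->
  `|Rintegral (mixture t p q) D f - Rintegral p D f| <= 2 * t%:num * M.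
Proof.
move=> M0 mD mf fM.
have ip := bounded_integrable p mD mf fM.
have iq := bounded_integrable q mD mf fM.
have -> : Rintegral (mixture t p q) D f =
    (1 - t%:num) * Rintegral p D f + t%:num * Rintegral q D f.
  rewrite /Rintegral /mixture integral_measure_add//.
  - have Ip := integrable_fin_num mD ip; have Iq := integrable_fin_num mD iq.
    by rewrite !integral_mscale//= fineD ?fineM ?fin_numM.
  - exact: (bounded_integrable (mscale (1 - t%:num)%:nng p) mD mf fM).
  - exact: (bounded_integrable (mscale (t%:num)%:nng q) mD mf fM).
have hp := normr_Rintegral_le p M0 mD mf fM.
have hq := normr_Rintegral_le q M0 mD mf fM.
rewrite (_ : _ - _ = t%:num * (Rintegral q D f - Rintegral p D f)); last by lra.
rewrite normrM ger0_norm// -mulrA mulrCA ler_wpM2l//.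
by apply: (le_trans (ler_normB _ _)); lra.
Qed.

End bounded.

(** * Borel sets and upper tails of coordinates *)

Section euclidean.
Context (R : realType) (n : nat).
Implicit Types (G : set 'rV[R]_n) (mu : probability (borel_rV R n) R).

Lemma open_borel G : open G -> measurable (G : set (borel_rV R n)).
Proof. by move=> oG; apply: sub_sigma_algebra. Qed.

Definition upper_tail (i : 'I_n) (a : R) : set 'rV[R]_n :=
  [set x | a < x 0 i].

Lemma measurable_upper_tail i a :
  measurable (upper_tail i a : set (borel_rV R n)).
Proof.
apply: open_borel.
apply: (@open_comp _ _ (fun x : 'rV[R]_n => x 0 i) [set y | a < y]).
  by move=> x _; exact: coord_continuous.
exact: open_gt.
Qed.

(** Preimages of open intervals are relatively open in [G], and a relatively
    open subset of the open set [G] is open. *)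
Lemma continuous_on_measurable G (f : 'rV[R]_n -> R) : open G ->
  {within G, continuous f} ->
  measurable_fun (G : set (borel_rV R n)) (f : borel_rV R n -> R).
Proof.
move=> oG cf.
apply: (measurability _ (measurable_realfun.RGenOpens.measurableE R)).
move=> _ [_ [a [b ->] <-]].
have /open_subspaceP[V oV VG] : open ((f : subspace G -> R) @^-1` `]a, b[).
  by move/continuousP : cf; apply; exact: interval_open.
by rewrite setIC -VG; apply: open_borel; exact: openI.
Qed.

(** The indicator of [X_i > a] is a nondecreasing function of the single
    coordinate [i], so it is an admissible test function, and for indicators
    the covariance inequality reads as stated. *)
Lemma upper_tails_NA mu (i j : 'I_n) (a b : R) :
  negatively_associated mu -> i != j ->
  (mu (upper_tail i a `&` upper_tail j b) <=
   mu (upper_tail i a) * mu (upper_tail j b))%E.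
Proof.
move=> NA ij.
(* The quantifier ranges over the only index of a one-coordinate vector: this
   avoids naming that index, which lives in an ordinal type bounded by
   the cardinal of a singleton. *)
pose f (k : 'I_n) (c : R) (y : 'rV[R]_#|[set k]%SET|) : R :=
  ([forall l, c < y 0 l])%:R.
have fE k c : on_coord (@f k c) = \1_(upper_tail k c).
  apply/funext => x; rewrite /on_coord /f indicE; congr (_%:R).
  congr nat_of_bool; apply/forallP/idP => [h|].
    have k1 : (0 < #|[set k]%SET|)%N by rewrite cards1.
    have := h (Ordinal k1); rewrite mxE.
    by have /set1P -> := enum_valP (Ordinal k1); rewrite inE.
  rewrite inE /upper_tail /= => cx l; rewrite mxE.
  by have /set1P -> := enum_valP l.
have ft k c : test_function mu (@f k c).
  split; last first.
    by rewrite fE; apply: integrable_indic; exact: measurable_upper_tail.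
  move=> x y yx; rewrite /f ler_nat.
  case: (boolP [forall l, c < y 0 l]) => // /forallP cy.
  suff -> : [forall l, c < x 0 l] by [].
  by apply/forallP => l; exact: lt_le_trans (yx l).
have dij : [disjoint [set i]%SET & [set j]%SET]%B.
  by rewrite disjoints1 inE.
have := NA _ _ dij _ _ (ft i a) (ft j b).
have mI := measurableI _ _ (measurable_upper_tail i a)
  (measurable_upper_tail j b).
rewrite !fE; under eq_integral do rewrite -[_ * _]/((\1__ \* \1__) _) -indicI.
rewrite !integral_indic ?setIT//; exact: measurable_upper_tail.
Qed.

Lemma open_shift G x : open G -> G x -> exists2 h, 0 < h & G (x + const_mx h).
Proof.
move=> oG Gx; have /nbhs_ballP[e /= e0 xe] := open_nbhs_nbhs (conj oG Gx).
exists (e / 2); first by rewrite divr_gt0.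
apply: xe; split => // i j; rewrite !mxE /ball/= opprD addNKr normrN.
rewrite gtr0_norm; lra.
Qed.

(** The values [x 0 i] for [x] in [G] form a set without maximum, because [G] is
    open.  Take a nondecreasing sequence [u] whose terms are dominated by such
    values and which eventually passes each of them: the tails [X_i > u k]
    decrease to a set disjoint from [G], hence [mu]-null, and by continuity from
    above their measures tend to zero. *)
Lemma small_upper_tail mu G i (e : R) : open G -> prob_on G mu -> 0 < e ->
  exists2 x, G x & (mu (upper_tail i (x 0%R i)) <= e%:E)%E.
Proof.
move=> oG muG e0.
have mT := measurable_upper_tail i.
have muGC : mu (~` G : set (borel_rV R n)) = 0%E.
  by rewrite probability_setC ?muG ?subee//; exact: open_borel.
have [x0 Gx0] : G !=set0.
  apply/set0P/eqP => G0; move: muG; rewrite /prob_on/= G0 measure0.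
  by move/esym/eqP; rewrite onee_eq0.
pose T : set R := [set x 0 i | x in G].
have Tlt x : G x -> exists2 h, 0 < h & T (x 0 i + h).
  move=> Gx; have [h h0 Gxh] := open_shift oG Gx.
  by exists h => //; exists (x + const_mx h) => //; rewrite !mxE.
have [u [u_nd uT Tu]] : exists u : nat -> R,
    [/\ {homo u : k l / (k <= l)%N >-> k <= l},
    forall k, exists2 x, G x & u k <= x 0 i &
    forall x, G x -> exists k, x 0 i <= u k].
  (* If the values are bounded, [u] approaches their supremum, which is not
     attained; otherwise [u] is the sequence of natural numbers. *)
  have [ubT|nubT] := pselect (has_ubound T).
    have hsT : has_sup T by split => //; exists (x0 0 i), x0.
    exists (fun k => sup T - k.+1%:R^-1); split.
    - by move=> k l kl; rewrite lerB// lef_pV2 ?posrE// ler_nat.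
    - move=> k; have k0 : 0 < k.+1%:R^-1 :> R by rewrite invr_gt0.
      have [_ [x Gx <-] /ltW xk] := sup_adherent k0 hsT.
      by exists x.
    - move=> x Gx; have [h h0 /(ub_le_sup ubT) xh] := Tlt x Gx.
      exists (Num.truncn h^-1); rewrite lerBrDr (le_trans _ xh)// lerD2l.
      rewrite -[leRHS]invrK lef_pV2 ?posrE ?invr_gt0//.
      exact/ltW/truncnS_gt.
  exists (fun k => k%:R); split.
  - by move=> k l kl; rewrite ler_nat.
  - move=> k; apply: contrapT => nk; apply: nubT; exists k%:R => _ [x Gx <-].
    by rewrite leNgt; apply/negP => /ltW kx; apply: nk; exists x.
  - move=> x _; exists (Num.truncn (x 0 i)).+1; exact/ltW/truncnS_gt.
pose F k : set (borel_rV R n) := upper_tail i (u k).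
have mF k : measurable (F k) by exact: mT.
have mIF : measurable (\bigcap_k F k) by exact: bigcap_measurableType.
have F0 : mu (\bigcap_k F k) = 0%E.
  apply/eqP; rewrite -measure_le0 -muGC le_measure ?inE//.
    by apply: measurableC; exact: open_borel.
  move=> x Fx /Tu[k xk]; have := Fx k I.
  by rewrite /F /upper_tail/= ltNge xk.
have F_ni : {homo F : k l / (k <= l)%N >-> (l <= k)%O}.
  move=> k l kl; apply/subsetPset => x; rewrite /F /upper_tail/=.
  exact/le_lt_trans/u_nd.
have F_fin : (mu (F 0%N) < +oo)%E by rewrite ltey_eq fin_num_measure.
have Fcvg : mu (F k) @[k --> \oo] --> 0%E.
  by rewrite -F0; exact: (nonincreasing_cvg_mu F_fin mF mIF F_ni).
have [k _ /(_ k (leqnn k))/= Fk] : nbhs \oo [set k | (mu (F k) < e%:E)%E].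
  apply: (Fcvg [set y | (y < e%:E)%E]).
  by apply: open_ereal_lt'; rewrite lte_fin.
have [x Gx ux] := uT k.
exists x => //; apply: le_trans (ltW Fk); apply: le_measure; rewrite ?inE//.
by move=> y; rewrite /F /upper_tail/=; exact: le_lt_trans.
Qed.

(** * A perturbation that correlates two coordinates positively *)

Fact half_ge0 : 0 <= 2^-1 :> R. Proof. by rewrite invr_ge0. Qed.
Fact half_le1 : 2^-1 <= 1 :> R. Proof. by rewrite invf_le1// ler1n. Qed.

Definition two_point (x z : 'rV[R]_n) : probability (borel_rV R n) R :=
  mixture (Itv01 half_ge0 half_le1) \d_(x : borel_rV R n) \d_(z : borel_rV R n).

Lemma two_pointE (x z : 'rV[R]_n) (A : set (borel_rV R n)) :
  two_point x z A = (2^-1 * (x \in A)%:R + 2^-1 * (z \in A)%:R)%:E.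
Proof.
rewrite /two_point [LHS]mixtureE /= !diracE -!EFinM -EFinD/=; congr (_%:E); lra.
Qed.

(** Both tails contain [x + const_mx h] and miss [x].  Under the mixture their
    intersection thus has measure at least [t/2], while the tails themselves
    have measure at most [t/2 + t^2/4] and [1 - t/2]; the bound [t^2/4] on the
    mass left by [mu] is what makes the product [t/2 - t^3/8]. *)
Lemma not_NA_two_point_mixture mu (i j : 'I_n) (x : 'rV[R]_n) (h : R)
    (t : {i01 R}) :
  i != j -> 0 < h -> 0 < t%:num ->
  (mu (upper_tail i (x 0%R i)) <= (t%:num ^+ 2 / 4)%:E)%E ->
  ~ negatively_associated (mixture t mu (two_point x (x + const_mx h))).
Proof.
move=> ij h0 t0 mux NA; have := upper_tails_NA (x 0 i) (x 0 j) NA ij.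
have mTi := measurable_upper_tail i (x 0 i).
have mTj := measurable_upper_tail j (x 0 j).
have mTI := measurableI _ _ mTi mTj.
have xT k : (x \in upper_tail k (x 0 k)) = false.
  by rewrite memNset// /upper_tail/= ltxx.
have zT k : (x + const_mx h) \in upper_tail k (x 0 k).
  by rewrite mem_set// /upper_tail/= !mxE ltrDl.
rewrite /= !mixtureE !two_pointE !in_setI !xT !zT /=.
have muE (A : set (borel_rV R n)) : measurable A ->
    exists2 p : R, 0 <= p <= 1 & mu A = p%:E.
  move=> mA; exists (fine (mu A)); last by rewrite fineK// fin_num_measure.
  rewrite fine_ge0//= -lee_fin fineK ?fin_num_measure//.
  exact: probability_le1.
have [p /andP[p0 _] pE] := muE _ mTi.
have [q /andP[q0 q1] qE] := muE _ mTj.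
have [r /andP[r0 _] rE] := muE _ mTI.
move: mux; rewrite pE qE rE -!EFinM -!EFinD !lee_fin mulr0 add0r mulr1.
have t1 : t%:num <= 1 by [].
move: t0 t1; set s := t%:num => s0 s1 ps.
have ps' : (1 - s) * p + s * 2^-1 <= s ^+ 2 / 4 + s / 2.
  by rewrite lerD2r (le_trans _ ps)// ler_piMl//; lra.
have qs' : (1 - s) * q + s * 2^-1 <= 1 - s / 2.
  have : (1 - s) * q <= 1 - s by rewrite ler_piMr//; lra.
  lra.
apply/negP; rewrite -ltNge.
apply: (@lt_le_trans _ _ (s / 2)); last first.
  by rewrite lerDr mulr_ge0//; lra.
apply: (@le_lt_trans _ _ ((s ^+ 2 / 4 + s / 2) * (1 - s / 2))).
  by apply: ler_pM => //; rewrite addr_ge0// mulr_ge0//; lra.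
have -> : (s ^+ 2 / 4 + s / 2) * (1 - s / 2) = s / 2 - s ^+ 3 / 8 by lra.
by rewrite ltrBlDr ltrDl divr_gt0// exprn_gt0.
Qed.

End euclidean.

(** * Density of the measures that are not negatively associated *)

Theorem proposition1 (R : realType) (n : nat) (n_ge2 : (2 <= n)%N)
    (G : set 'rV[R]_n) (openG : open G)
    (mu : probability (borel_rV R n) R) (muG : prob_on G mu)
    (mu_strictNA : strictly_negatively_associated mu)
    (U : set (probability (borel_rV R n) R)) (nbhsU : weak_nbhs G mu U) :
  exists nu : probability (borel_rV R n) R,
    [/\ prob_on G nu, U nu & ~ negatively_associated nu].
Proof.
have [k [f [eps [fbc eps0 subU]]]] := nbhsU.
have [t /andP[t0 t1] tP] : exists2 t : R, 0 < t < 1 &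
    forall i, exists2 M : R, forall x, G x -> `|f i x| <= M & 2 * t * M < eps i.
  have : \forall t \near 0^'+, forall i : 'I_k,
      exists2 M : R, forall x, G x -> `|f i x| <= M & 2 * t * M < eps i.
    apply: filter_forall => i; have [_ [M fM]] := fbc i.
    have M1 : 0 < 2 * `|M| + 1 by rewrite ltr_wpDl// mulr_ge0.
    near=> t; exists M => //.
    have t0 : 0 < t by near: t; exact: nbhs_right_gt.
    have : t < eps i / (2 * `|M| + 1).
      by near: t; apply: nbhs_right_lt; rewrite divr_gt0.
    rewrite ltr_pdivlMr// => /(le_lt_trans _); apply.
    have : t * M <= t * `|M| by rewrite ler_pM2l// ler_norm.
    lra.
  move=> ft; near (0 : R)^'+ => t; exists t; last by near: t.
  apply/andP; split; near: t; [exact: nbhs_right_gt|exact: nbhs_right_lt].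
pose s := Itv01 (ltW t0) (ltW t1).
pose i0 := Ordinal (ltnW n_ge2 : 0 < n)%N.
pose i1 := Ordinal (n_ge2 : 1 < n)%N.
have tt : 0 < t ^+ 2 / 4 by rewrite divr_gt0// exprn_gt0.
have [x Gx mux] := small_upper_tail i0 openG muG tt.
have [h h0 Gz] := open_shift openG Gx.
pose nu := mixture s mu (two_point x (x + const_mx h)) : probability _ _.
have nuG : prob_on G nu.
  rewrite /prob_on/= mixtureE two_pointE !mem_set// muG mule1 -EFinM -EFinD.
  by congr (_%:E) => /=; lra.
exists nu; split => //; last exact: (@not_NA_two_point_mixture _ _ mu i0 i1).
apply: subU; split => // i; have [M fM] := tP i.
apply: le_lt_trans; have [cf _] := fbc i.
apply: (@Rintegral_mixture_dist _ _ _ s) => //.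
- exact: le_trans (fM x Gx).
- exact: open_borel.
- exact: continuous_on_measurable.
Unshelve. all: by end_near.
Qed.
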